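(* Starting with an empty graph on $n$ vertices, under any sequence of edge insertions that keeps the graph bipartite, an implicit 2-coloring can be maintained deterministically with amortized $O(\alpha(n))$ update time, amortized $O(\alpha(n))$ query time, and amortized $O(\alpha(n))$ recolorings per update, where $\alpha(n)$ is the inverse Ackermann function.
   Context: An implicit coloring algorithm does not necessarily store the color of every vertex after each update; instead, a query $\mathsf{getColor}(v)$ computes the color of $v$, and at every moment the colors returned by queries form a proper coloring (adjacent vertices receive different colors) of the current graph using two colors. A recoloring is a change of a stored color value during an update. *)

(* Defs.v *)
From mathcomp Require Import all_boot.

Set Implicit Arguments.
Unset Strict Implicit.
Unset Printing Implicit Defensive.

(* Ackermann-Peter convention. *)
Fixpoint ack (m : nat) : nat -> nat :=
  fix ack_m (n : nat) : nat :=
    match m, n with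
    | 0, _ => n.+1
    | m'.+1, 0 => ack m' 1
    | m'.+1, n'.+1 => ack m' (ack_m n')
    end.

Lemma ltn_ack m n : n < ack m n.
Proof.
elim: m n => [|m IHm] n; first by case: n.
elim: n => [|n IHn]; first exact: leq_trans (IHm 1).
exact: leq_ltn_trans IHn (IHm _).
Qed.

Lemma alpha_exists n : exists k, (0 < k) && (n <= ack k k).
Proof. by exists n.+1; apply: leq_trans (ltnW (ltn_ack n.+1 n.+1)). Qed.

(* The least k >= 1 with n <= ack k k; in particular alpha n is never 0, so
   that O(alpha n) bounds are meaningful for every n. *)
Definition alpha (n : nat) : nat := ex_minn (alpha_exists n).

Definition reg := nat.
Definition addr := nat.

(* A unit-cost RAM with w-bit words; w is a parameter of the semantics. *)
Inductive test := TEq of reg & reg | TLt of reg & reg.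

Inductive cmd :=
  | Skip
  | Const of reg & nat             (* x := k *)
  | Move of reg & reg              (* x := y *)
  | Add of reg & reg & reg         (* x := y + z, modulo 2^w *)
  | Sub of reg & reg & reg         (* x := y - z, truncated at 0 *)
  | Read of reg & reg              (* x := mem[y] *)
  | Write of reg & reg             (* mem[x] := y *)
  | Seq of cmd & cmd
  | If of test & cmd & cmd
  | While of test & cmd.

Definition memory := addr -> nat.

Record state := State { regs : reg -> nat; mem : memory }.

Definition set_reg (s : state) (x : reg) (k : nat) : state :=
  State [eta regs s with x |-> k] (mem s).

Definition set_mem (s : state) (a : addr) (k : nat) : state :=
  State (regs s) [eta mem s with a |-> k].

Definition eval_test (b : test) (s : state) : bool :=
  match b with
  | TEq x y => regs s x == regs s y
  | TLt x y => regs s x < regs s y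
  end.

(* [exec w c s t ch s']: with w-bit words, c started in s terminates in s' after
   t unit-cost steps; ch lists, with multiplicity, the addresses of the memory
   cells whose content was changed by a write. *)
Inductive exec (w : nat) :
    cmd -> state -> nat -> seq addr -> state -> Prop :=
  | exec_skip s : exec w Skip s 1 [::] s
  | exec_const s x k :
      exec w (Const x k) s 1 [::] (set_reg s x (k %% 2 ^ w))
  | exec_move s x y : exec w (Move x y) s 1 [::] (set_reg s x (regs s y))
  | exec_add s x y z :
      exec w (Add x y z) s 1 [::]
        (set_reg s x ((regs s y + regs s z) %% 2 ^ w))
  | exec_sub s x y z :
      exec w (Sub x y z) s 1 [::] (set_reg s x (regs s y - regs s z))
  | exec_read s x y :
      exec w (Read x y) s 1 [::] (set_reg s x (mem s (regs s y)))
  | exec_write s x y :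
      exec w (Write x y) s 1
        (if mem s (regs s x) == regs s y then [::] else [:: regs s x])
        (set_mem s (regs s x) (regs s y))
  | exec_seq c1 c2 s1 s2 s3 t1 t2 ch1 ch2 :
      exec w c1 s1 t1 ch1 s2 -> exec w c2 s2 t2 ch2 s3 ->
      exec w (Seq c1 c2) s1 (t1 + t2) (ch1 ++ ch2) s3
  | exec_if b c1 c2 s t ch s' :
      exec w (if eval_test b s then c1 else c2) s t ch s' ->
      exec w (If b c1 c2) s t.+1 ch s'
  | exec_while_end b c s :
      ~~ eval_test b s -> exec w (While b c) s 1 [::] s
  | exec_while_step b c s1 s2 s3 t1 t2 ch1 ch2 :
      eval_test b s1 ->
      exec w c s1 t1 ch1 s2 -> exec w (While b c) s2 t2 ch2 s3 ->
      exec w (While b c) s1 (t1 + t2).+1 (ch1 ++ ch2) s3.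

Lemma exec_det w c s t1 ch1 s1 t2 ch2 s2 :
  exec w c s t1 ch1 s1 -> exec w c s t2 ch2 s2 ->
  [/\ t1 = t2, ch1 = ch2 & s1 = s2].
Proof.
move=> e1; elim: e1 t2 ch2 s2 => {c s t1 ch1 s1};
  try by [move=> *; match goal with H : exec _ _ _ _ _ _ |- _ => inversion H end].
- move=> c1 c2 s1 s2 s3 t1 t2 ch1 ch2 _ IH1 _ IH2 t ch s e.
  inversion e as [| | | | | | |? ? ? ? ? ? ? ? ? e1 e2| | |]; subst.
  case: (IH1 _ _ _ e1) => ? ? ?; subst.
  by case: (IH2 _ _ _ e2) => ? ? ?; subst.
- move=> b c1 c2 s t ch s' _ IH t2 ch2 s2 e.
  inversion e as [| | | | | | | |? ? ? ? ? ? ? e1| |]; subst.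
  by case: (IH _ _ _ e1) => ? ? ?; subst.
- move=> b c s /negbTE nb t2 ch2 s2 e.
  inversion e as [| | | | | | | | | |? ? ? ? ? ? ? ? ? hb]; subst => //.
  by rewrite hb in nb.
- move=> b c s1 s2 s3 t1 t2 ch1 ch2 hb _ IH1 _ IH2 t ch s e.
  inversion e as [| | | | | | | | |? ? ? nb|? ? ? ? ? ? ? ? ? ? e1 e2]; subst.
    by rewrite hb in nb.
  case: (IH1 _ _ _ e1) => ? ? ?; subst.
  by case: (IH2 _ _ _ e2) => ? ? ?; subst.
Qed.

(* Words of Theta(log n) bits; for c > 0 every number up to n fits in a word. *)
Definition word_size (c n : nat) : nat := c * (trunc_log 2 n).+1.

Inductive op (n : nat) :=
  | Insert of 'I_n & 'I_n
  | GetColor of 'I_n.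

Definition is_update n (o : op n) : bool :=
  if o is Insert _ _ then true else false.

Definition is_query n (o : op n) : bool := ~~ is_update o.

(* Adjacency in the graph obtained from the empty graph on 'I_n by the history
   of operations h. *)
Definition adj n (h : seq (op n)) : rel 'I_n := fun u v =>
  has (fun o => if o is Insert x y
                then (x == u) && (y == v) || (x == v) && (y == u)
                else false) h.

Definition bipartite n (e : rel 'I_n) : Prop :=
  exists A : {set 'I_n}, forall u v, e u v -> (u \in A) != (v \in A).

Definition proper_coloring n (e : rel 'I_n) (f : 'I_n -> bool) : Prop :=
  forall u v, e u v -> f u != f v.

Record data_structure := DataStructure {
  init_code : cmd;
  insert_code : cmd;
  get_color_code : cmd
}.

(* Registers hold only the arguments when a procedure starts, so everything
   that persists from one operation to the next is in memory. *)
Definition start (args : seq nat) (m : memory) : state := State (nth 0 args) m.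

Record outcome := Outcome {
  cost : nat;
  changed : seq addr;
  answer : nat   (* content of register 0; only meaningful for queries *)
}.

Definition op_code (D : data_structure) n (o : op n) : cmd :=
  match o with
  | Insert _ _ => insert_code D
  | GetColor _ => get_color_code D
  end.

Definition op_args n (o : op n) : seq nat :=
  match o with
  | Insert u v => [:: val u; val v]
  | GetColor v => [:: val v]
  end.

Definition op_step (w : nat) (D : data_structure) n (o : op n)
    (m : memory) (r : outcome) (m' : memory) : Prop :=
  exists2 s : state,
    exec w (op_code D o) (start (op_args o) m) (cost r) (changed r) s &
    mem s = m' /\ regs s 0 = answer r.

(* Initialization starts from a zeroed memory, with n in register 0. *)
Definition init_step (w : nat) (D : data_structure) (n t : nat)
    (m : memory) : Prop :=
  exists ch s,
    exec w (init_code D) (start [:: n] (fun=> 0)) t ch s /\ mem s = m.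

Inductive run (w : nat) (D : data_structure) (n : nat) (m0 : memory) :
    seq (op n) -> seq outcome -> memory -> Prop :=
  | run_nil : run w D m0 [::] [::] m0
  | run_rcons h tr m o r m' :
      run w D m0 h tr m -> op_step w D o m r m' ->
      run w D m0 (rcons h o) (rcons tr r) m'.

Definition total_time (tr : seq outcome) : nat := \sum_(r <- tr) cost r.

(* Changes, during updates, of the values kept in the cells designated by
   color_cell. *)
Definition recolorings (color_cell : pred addr) n (h : seq (op n))
    (tr : seq outcome) : nat :=
  \sum_(p <- zip h tr | is_update p.1) count color_cell (changed p.2).

(* Main.v *)
From mathcomp Require Import all_boot zify.
Require Import Defs.

(* The vertices are kept in a union-find forest with union by rank and path
   compression, in which every vertex also stores the parity of the edge to its
   parent; the color of a vertex is the parity of its path to the root. Which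
   root wins a union, and hence the coloring, depends on the insertions only,
   and inside a tree the parities agree, up to a flip, with every proper
   2-coloring of the graph.

   The time analysis is Tarjan's. Write r for rank + 1. A root has potential
   a * rank, where a = alpha n + 2. A non-root with parameter r whose parent has
   parameter s has as potential the number of thresholds (grow k)^(i+1)(r), k < a and
   i <= r, that s has not reached. Compressing a path releases one unit for each
   of its vertices except at most one per level k < a, and a union adds at most
   3a. Singletons have potential 0, so no term in n remains. Queries never
   increase the potential, so the time spent in updates, and with it the number
   of recolorings, is paid for by the updates alone. *)

Set Implicit Arguments.
Unset Strict Implicit.
Unset Printing Implicit Defensive.

(** * A fast-growing hierarchy and the inverse Ackermann function *)

(** The hierarchy A_k(j) of the textbook analysis of union-find; its iterations start at j, those of
    [ack] at 1. *)
Fixpoint grow (k j : nat) : nat :=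
  if k is k'.+1 then iter j.+1 (grow k') j else j.+1.

Lemma iter_homo (f : nat -> nat) i :
  {homo f : x y / x <= y} -> {homo iter i f : x y / x <= y}.
Proof. by move=> f_homo x y le_xy; elim: i => //= i; apply: f_homo. Qed.

Lemma leq_iter_infl (f : nat -> nat) x i j :
  (forall y, y <= f y) -> i <= j -> iter i f x <= iter j f x.
Proof.
move=> f_infl /subnK <-; rewrite iterD.
by elim: (j - i) => //= k IHk; apply: leq_trans (f_infl _).
Qed.

Lemma ltn_grow k j : j < grow k j.
Proof.
elim: k j => //= k IHk j; apply: leq_ltn_trans (IHk _).
by apply: (@leq_iter_infl _ _ 0) => // y; apply: ltnW.
Qed.

Lemma leq_grow k : {homo grow k : x y / x <= y}.
Proof.
elim: k => [|k IHk] x y le_xy; first by rewrite /= ltnS.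
rewrite /= -!iterS; apply: leq_trans (iter_homo _ IHk le_xy) _.
by apply: leq_iter_infl => // z; apply/ltnW/ltn_grow.
Qed.

Lemma growS k j : grow k.+1 j = iter j.+1 (grow k) j. Proof. by []. Qed.

Lemma ackS_iter k j : ack k.+1 j = iter j.+1 (ack k) 1.
Proof. by elim: j => //= j <-. Qed.

(** Both sides are (j+1)-fold iterates of the level below, started at 1 and at j >= 1; the iterates
    of [ack] from 1 are positive, so the induction hypothesis applies to them. *)
Lemma ack_grow k j : 0 < j -> ack k j <= grow k j.
Proof.
elim: k j => [|k IHk] j j_gt0; first by case: j j_gt0.
rewrite ackS_iter growS.
apply: leq_trans (_ : iter j.+1 (grow k) 1 <= _); last exact/iter_homo/j_gt0/leq_grow.
elim: (j.+1) => // i IHi; rewrite !iterS; apply: leq_trans (IHk _ _) (leq_grow _ IHi).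
by elim: i {IHi} => // i IHi; rewrite iterS; apply: leq_ltn_trans (ltn_ack _ _).
Qed.

Lemma grow1_gt k : k < grow k 1.
Proof. by elim: k => // k IHk; apply: leq_ltn_trans IHk (ltn_grow _ _). Qed.

Lemma alphaP n : 0 < alpha n /\ n <= ack (alpha n) (alpha n).
Proof. by rewrite /alpha; case: ex_minnP => k /andP[]. Qed.

(** With a = [alpha n], level a + 1 at 1 is [grow a (grow a 1)], which is at least [grow a a] and
    hence at least n; one more level makes the inequality strict. *)
Lemma grow_alpha n r : 0 < r -> n < grow (alpha n).+2 r.
Proof.
move=> r_gt0; have [a_gt0 le_na] := alphaP n; set a := alpha n in a_gt0 le_na *.
apply: leq_trans (leq_grow _ r_gt0); apply: leq_ltn_trans (ltn_grow a.+1 _).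
apply: leq_trans (leq_trans le_na (ack_grow _ a_gt0)) _.
exact: leq_grow (ltnW (grow1_gt a)).
Qed.

(** * Thresholds and levels *)

Definition psi (a r s : nat) : nat :=
  #|[set p : 'I_a * 'I_r.+1 | s < iter p.2.+1 (grow p.1) r]|.

Lemma psi_max a r s : psi a r s <= a * r.+1.
Proof. by apply: leq_trans (max_card _) _; rewrite card_prod !card_ord. Qed.

Lemma psi_anti a r s s' : s <= s' -> psi a r s' <= psi a r s.
Proof.
move=> le_ss'; apply/subset_leq_card/subsetP=> p; rewrite !inE.
exact: leq_ltn_trans.
Qed.

Lemma psi_drop a r s s' k i : k < a -> i <= r ->
  s < iter i.+1 (grow k) r <= s' -> psi a r s' < psi a r s.
Proof.
move=> lt_ka le_ir /andP[lt_s le_s']; apply/proper_card/properP; split.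
  apply/subsetP=> p; rewrite !inE; apply: leq_ltn_trans.
  exact/ltnW/(leq_trans lt_s).
by exists (Ordinal lt_ka, Ordinal (le_ir : i < r.+1)); rewrite !inE //= -leqNgt.
Qed.

(** Tarjan's level: for r < s < [grow a r], the largest k with [grow k r <= s]. *)
Definition level (a r s : nat) : nat :=
  find (fun k => s < grow k.+1 r) (iota 0 a).

Lemma levelP a r s : r < s < grow a r ->
  [/\ level a r s < a, grow (level a r s) r <= s & s < grow (level a r s).+1 r].
Proof.
case/andP=> lt_rs lt_sa; rewrite /level; set P := fun k => _.
have a_gt0 : 0 < a by case: a lt_sa; rewrite //= ltnNge lt_rs.
have hasP : has P (iota 0 a).
  by apply/hasP; exists a.-1; rewrite ?mem_iota /P prednK //=.
have lt_fa : find P (iota 0 a) < a by move: hasP; rewrite has_find size_iota.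
have := nth_find 0 hasP; rewrite nth_iota // add0n /P => lt_s; split=> //.
(* At level 0 the bound [grow 0 r <= s] is r < s; otherwise it says that the preceding index failed
   the test. *)
case def_k: {1}(find _ _) => [|k] //.
rewrite leqNgt; have := @before_find _ 0 P (iota 0 a) k.
by rewrite def_k leqnn nth_iota ?add0n; [move=> /(_ isT)/negbT | rewrite ltnW // -def_k].
Qed.

(* If x sits below y on a path and both have level k, moving x to the top of
   the path passes at least one more threshold grow k^(i+1)(x). *)
Lemma psi_same_level a k r s r' s' s'' : k < a ->
  grow k r <= s < grow k.+1 r -> s <= r' -> grow k r' <= s' <= s'' ->
  psi a r s'' < psi a r s.
Proof.
move=> lt_ka /andP[le_rs lt_s] le_sr' /andP[le_r's' le_s's''].
(* The exponent i = r gives [grow k.+1 r], so some iterate exceeds s. The least such i is positive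
   because [grow k r <= s]; the iterate before it is at most s <= r', so this one is at most
   [grow k r' <= s']. *)
have ex_i : exists i, (i <= r) && (s < iter i.+1 (grow k) r).
  by exists r; rewrite leqnn.
case: (ex_minnP ex_i) => [[|i]] /andP[le_ir lt_si] min_i.
  by rewrite ltnNge le_rs in lt_si.
apply: (psi_drop lt_ka le_ir); rewrite lt_si /= (leq_trans _ le_s's'') //.
apply: leq_trans le_r's'; apply: leq_grow; apply: leq_trans le_sr'.
rewrite leqNgt; apply/negP=> lt_s'; have := min_i i.
by rewrite ltnW // iterS lt_s' ltnn => /(_ isT).
Qed.

(** * The abstract forest and its coloring *)

(* The part of the data structure that path compression leaves unchanged. *)
Record forest n := Forest {
  rep : 'I_n -> 'I_n;
  color : 'I_n -> bool;
  rank : 'I_n -> nat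
}.

Definition empty_forest n : forest n := Forest id (fun=> false) (fun=> 0).

Definition link n (F : forest n) (x y : 'I_n) (flip : bool) : forest n :=
  Forest (fun z => if rep F z == x then y else rep F z)
         (fun z => color F z (+) (rep F z == x) && flip)
         (fun z => if (z == y) && (rank F x == rank F y) then (rank F z).+1
                   else rank F z).

(** [flip] holds when u and v have equal colors, so that toggling the whole absorbed tree separates
    them. *)
Definition unite n (F : forest n) (u v : 'I_n) : forest n :=
  let flip := ~~ (color F u (+) color F v) in
  if rep F u == rep F v then F
  else if rank F (rep F u) < rank F (rep F v)
       then link F (rep F u) (rep F v) flip
       else link F (rep F v) (rep F u) flip.

Definition forest_step n (F : forest n) (o : op n) : forest n :=
  if o is Insert u v then unite F u v else F.

Definition forest_of n (h : seq (op n)) : forest n :=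
  foldl (@forest_step n) (empty_forest n) h.

(** [rank_class] is a weak form of 2^rank <= class size, sufficient to keep ranks below n. *)
Record forest_ok n (F : forest n) : Prop := ForestOk {
  rep_idem : forall x, rep F (rep F x) = rep F x;
  color_rep : forall x, color F (rep F x) = false;
  rank_class : forall x, rep F x = x -> rank F x < #|[set y | rep F y == x]|;
  rank_lt : forall x, rank F x < n
}.

Lemma empty_forest_ok n : forest_ok (empty_forest n).
Proof.
split=> //= x; last by apply: leq_ltn_trans (ltn_ord x).
by rewrite card_gt0; move=> _; apply/set0Pn; exists x; rewrite inE.
Qed.

(** On a tie both classes have at least rank + 1 elements, so their union has more than rank + 1 and
    the increased rank is still below n. *)
Lemma link_ok n (F : forest n) x y flip : forest_ok F ->
  rep F x = x -> rep F y = y -> x != y -> rank F x <= rank F y ->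
  forest_ok (link F x y flip).
Proof.
case=> idem col0 cls lt_n rx ry ne_xy le_r.
have class_link : #|[set z | rep (link F x y flip) z == y]| =
    #|[set z | rep F z == x]| + #|[set z | rep F z == y]|.
  have disj : [set z | rep F z == x] :&: [set z | rep F z == y] = set0.
    by apply/setP=> z; rewrite !inE; apply/negP=> /andP[/eqP->]; apply/negP.
  rewrite -cardsUI disj cards0 addn0; apply: eq_card => z; rewrite !inE /=.
  by case: (rep F z =P x) => //= _; rewrite eqxx.
have rank_y : (if rank F x == rank F y then (rank F y).+1 else rank F y) <
    #|[set z | rep (link F x y flip) z == y]|.
  rewrite class_link; have := cls _ rx; have := cls _ ry; case: eqP; lia.
split=> [z|z|z|z] /=.
- case: (rep F z =P x) => [_|/eqP ne]; first by rewrite ry eq_sym (negbTE ne_xy).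
  by rewrite idem (negbTE ne).
- case: (rep F z =P x) => [_|/eqP ne]; first by rewrite -{1}ry col0 ry eq_sym (negbTE ne_xy).
  by rewrite col0 idem (negbTE ne).
- case: (rep F z =P x) => [_ <-|/eqP ne rz]; first by rewrite eqxx.
  case: (z =P y) => [->|/eqP ne_zy]; first by [].
  rewrite (_ : [set _ | _] = [set t | rep F t == z]); first exact: cls.
  apply/setP=> t; rewrite !inE; case: (rep F t =P x) => [->|//].
  rewrite eq_sym (negbTE ne_zy) eq_sym; apply/esym/negbTE.
  by rewrite -rz.
- case: (z =P y) => [->|_] /=; last exact: lt_n.
  apply: leq_trans rank_y _; rewrite -[X in _ <= X]card_ord; exact: max_card.
Qed.

Lemma unite_ok n (F : forest n) u v : forest_ok F -> forest_ok (unite F u v).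
Proof.
move=> okF; rewrite /unite; case: ifP => // /negbT ne.
by case: ltnP => [/ltnW|] le; apply: link_ok; rewrite ?rep_idem // eq_sym.
Qed.

Lemma forest_of_rcons n (h : seq (op n)) o :
  forest_of (rcons h o) = forest_step (forest_of h) o.
Proof. by rewrite /forest_of foldl_rcons. Qed.

Lemma forest_of_ok n (h : seq (op n)) : forest_ok (forest_of h).
Proof.
elim/last_ind: h => [|h o IHh]; first exact: empty_forest_ok.
by rewrite forest_of_rcons; case: o => //= u v; apply: unite_ok.
Qed.

(** Comparing differences expresses agreement with A up to one flip per tree. *)
Definition colors_like n (F : forest n) (A : {set 'I_n}) : Prop :=
  forall x y, rep F x = rep F y ->
  color F x (+) color F y = (x \in A) (+) (y \in A).

(** Color differences between a in the tree of u and b in that of v add up along a, u, v, b; the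
    flip makes u and v differ, as A demands. *)
Lemma link_colors n (F : forest n) (A : {set 'I_n}) x y u v :
  forest_ok F -> colors_like F A -> rep F u = x -> rep F v = y ->
  (u \in A) != (v \in A) ->
  colors_like (link F x y (~~ (color F u (+) color F v))) A.
Proof.
move=> okF FA ru rv Auv s t /=.
have swap a b : rep F a = x -> rep F b = y ->
    color F a (+) ~~ (color F u (+) color F v) (+) color F b =
    (a \in A) (+) (b \in A).
  move=> ra rb; have := FA a u; have := FA b v; rewrite ra rb ru rv.
  move=> /(_ erefl) Hb /(_ erefl) Ha; move: Ha Hb Auv.
  by do 4!case: (color _ _); do 4!case: (_ \in A).
case: (rep F s =P x) => [rs|_]; case: (rep F t =P x) => [rt|_] //= E.
- have := FA s t; rewrite rs rt => /(_ erefl) <-.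
  by case: (~~ _); do 2!case: (color F _).
- by rewrite addbF swap.
- by rewrite addbF [LHS]addbC swap ?rt // addbC.
- by rewrite !addbF FA.
Qed.

Lemma adj_rcons n (h : seq (op n)) o x y :
  adj (rcons h o) x y = adj h x y || adj [:: o] x y.
Proof. by rewrite /adj -cats1 has_cat. Qed.

(** A bipartition of the final graph also serves every prefix, so A stays fixed in the induction. *)
Lemma forest_of_colors n (h : seq (op n)) (A : {set 'I_n}) :
  (forall x y, adj h x y -> (x \in A) != (y \in A)) ->
  colors_like (forest_of h) A /\
  forall x y, adj h x y -> rep (forest_of h) x = rep (forest_of h) y.
Proof.
elim/last_ind: h => [|h o IHh] hA.
  by split=> // x y /= ->; rewrite addbb.
have [|FA same] := IHh; first by move=> x y xy; apply: hA; rewrite adj_rcons xy.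
have okF := forest_of_ok h; rewrite forest_of_rcons.
case: o hA => [u v|u] hA /=; last first.
  by split=> // x y; rewrite adj_rcons orbF; apply: same.
have Auv : (u \in A) != (v \in A).
  by apply: hA; rewrite adj_rcons /= !eqxx orbT.
have same_rep : let F' := unite (forest_of h) u v in
    rep F' u = rep F' v /\
    forall x y, rep (forest_of h) x = rep (forest_of h) y -> rep F' x = rep F' y.
  rewrite /unite; case: eqP => [|_] //=; case: ltnP => _ /=; split.
  - by rewrite eqxx; case: eqP.
  - by move=> x y ->.
  - by rewrite eqxx; case: eqP.
  - by move=> x y ->.
split; last first.
  move=> x y; rewrite adj_rcons => /orP[/same|/=]; first by apply: (same_rep.2).
  by rewrite orbF; case/orP=> /andP[/eqP<- /eqP<-]; case: same_rep.
rewrite /unite; case: eqP => // _; case: ltnP => _; first exact: link_colors.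
by rewrite addbC; apply: link_colors; rewrite // eq_sym.
Qed.

Lemma color_proper n (h : seq (op n)) :
  bipartite (adj h) -> proper_coloring (adj h) (color (forest_of h)).
Proof.
case=> A hA u v uv; have [FA same] := forest_of_colors hA.
by have := hA _ _ uv; have := FA _ _ (same _ _ uv); do 2!case: color; do 2!case: (_ \in A).
Qed.

(** * Paths to the root, compression and the potential *)

Section Paths.
Variables (n : nat) (F : forest n) (a : nat).
Implicit Types (pa : 'I_n -> 'I_n) (x y z : 'I_n) (s : seq 'I_n).

Record parents_ok pa : Prop := ParentsOk {
  rep_parent : forall x, rep F (pa x) = rep F x;
  root_parent : forall x, (pa x == x) = (rep F x == x);
  rank_parent : forall x, pa x != x -> rank F x < rank F (pa x)
}.

(* s lists the vertices strictly below the root z on the path from x. *)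
Fixpoint root_path pa x s z : Prop :=
  if s is y :: s' then [/\ y = x, pa x != x & root_path pa (pa x) s' z]
  else x = z /\ pa z == z.

Definition compress pa s z : 'I_n -> 'I_n := fun y => if y \in s then z else pa y.

Definition potential pa : nat :=
  \sum_x if pa x == x then a * rank F x
         else psi a (rank F x).+1 (rank F (pa x)).+1.

Lemma root_path_end pa x s z : root_path pa x s z -> pa z == z.
Proof. by elim: s x => [|y s IHs] x /=; [case | case=> _ _ /IHs]. Qed.

Lemma root_path_nonroot pa x s z y :
  root_path pa x s z -> y \in s -> pa y != y.
Proof.
elim: s x => [|t s IHs] x //= [-> nx /IHs IH]; rewrite inE.
by case/predU1P=> [->|/IH].
Qed.

Lemma root_path_notin pa x s z : root_path pa x s z -> z \notin s.
Proof.
by move=> p; apply/negP=> /(root_path_nonroot p); rewrite (root_path_end p).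
Qed.

Hypotheses (okF : forest_ok F).

(** Ranks increase strictly towards the root and stay below n, hence the induction on n - rank. *)
Lemma root_path_exists pa x : parents_ok pa ->
  exists s, root_path pa x s (rep F x).
Proof.
move=> [rp ro rk]; move: {2}(n - rank F x) (leqnn (n - rank F x)) => k.
elim: k x => [|k IHk] x le_k.
  by have := rank_lt okF x; rewrite -subn_gt0; case: (n - _) le_k.
case: (boolP (pa x == x)) => rx.
  by exists [::]; split; [apply/esym/eqP; rewrite -ro | rewrite ro (rep_idem okF)].
have [|s p] := IHk (pa x); first by have := rk _ rx; lia.
by exists (x :: s); split=> //; rewrite -(rp x).
Qed.

Section OnePath.
Variables (pa : 'I_n -> 'I_n) (ok_pa : parents_ok pa).

Lemma root_path_rep x s z : root_path pa x s z -> z = rep F x.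
Proof.
elim: s x => [|y s IHs] x /= [].
  by move=> -> ; rewrite (root_parent ok_pa) => /eqP.
by move=> _ _ /IHs ->; apply: rep_parent ok_pa _.
Qed.

Lemma root_path_mem x s z y : root_path pa x s z -> y \in s ->
  [/\ rep F y = z, rank F x <= rank F y & rank F (pa y) <= rank F z].
Proof.
have le_end t s' : root_path pa t s' z -> rank F t <= rank F z.
  elim: s' t => [|u s' IHs] t /= [] => [->|_ nt /IHs] //.
  by apply: leq_trans; apply/ltnW/rank_parent.
elim: s x => [|t s IHs] x // p; have := root_path_rep p.
case: p => -> nx p def_z; rewrite inE => /predU1P[->|y_s].
  by split=> //; apply: le_end p.
have [-> le_xy le_yz] := IHs _ p y_s; split=> //.
by apply: leq_trans le_xy; apply/ltnW/rank_parent.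
Qed.

Lemma root_path_uniq x s z : root_path pa x s z -> uniq s.
Proof.
elim: s x => [|t s IHs] x //= [-> nx p]; rewrite (IHs _ p) andbT.
apply/negP=> /(root_path_mem p)[_ le_x _].
by have := rank_parent ok_pa nx; rewrite ltnNge le_x.
Qed.

(** Feeds [psi_same_level], which compares the parent of the lower vertex with the upper vertex;
    which of the two is lower is left open. *)
Lemma root_path_order x s z y1 y2 : root_path pa x s z ->
  y1 \in s -> y2 \in s -> y1 != y2 ->
  rank F (pa y1) <= rank F y2 \/ rank F (pa y2) <= rank F y1.
Proof.
elim: s x => [|t s IHs] x //= [-> nx p]; rewrite !inE.
case/predU1P=> [->|s1] /predU1P[->|s2]; rewrite ?eqxx // => ne.
- by left; case: (root_path_mem p s2).
- by right; case: (root_path_mem p s1).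
- exact: IHs p s1 s2 ne.
Qed.

Lemma compress_ok x s z : root_path pa x s z -> parents_ok (compress pa s z).
Proof.
move=> p; have nzs := root_path_notin p.
have rz : rep F z = z by apply/eqP; rewrite -(root_parent ok_pa) (root_path_end p).
split=> y; rewrite /compress; case: ifP => [ys|_];
  try by [apply: rep_parent | apply: root_parent | apply: rank_parent].
- by case: (root_path_mem p ys) => -> _ _.
- rewrite -(root_parent ok_pa) (negbTE (root_path_nonroot p ys)).
  by apply/eqP=> zy; rewrite zy ys in nzs.
- move=> _; apply: leq_trans (rank_parent ok_pa (root_path_nonroot p ys)) _.
  by case: (root_path_mem p ys).
Qed.

Hypothesis grow_a : forall r, 0 < r -> n < grow a r.

(* Each vertex of the path loses potential when it is moved below z, except
   the last one of each level. *)
Lemma compress_potential x s z : root_path pa x s z ->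
  potential (compress pa s z) + size s <= potential pa + a.
Proof.
move=> p; have us := root_path_uniq p; have nzs := root_path_notin p.
pose r y := (rank F y).+1.
pose drops y := psi a (r y) (r z) < psi a (r y) (r (pa y)).
have lev y : y \in s -> [/\ level a (r y) (r (pa y)) < a,
    grow (level a (r y) (r (pa y))) (r y) <= r (pa y) &
    r (pa y) < grow (level a (r y) (r (pa y))).+1 (r y)].
  (* The shift to rank + 1 keeps the argument of [grow] positive, and the parameter of the parent is
     at most n, hence below [grow a]. *)
  move=> ys; apply: levelP; rewrite ltnS (rank_parent ok_pa) ?(root_path_nonroot p ys) //=.
  exact: leq_ltn_trans (rank_lt okF _) (grow_a _).
(* Of two path vertices with equal level the lower one drops by [psi_same_level]; so the vertices
   that do not drop have distinct levels, all below a. *)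
have few_stay : size [seq y <- s | ~~ drops y] <= a.
  rewrite -(size_map (fun y => level a (r y) (r (pa y)))).
  rewrite -[X in _ <= X](size_iota 0); apply: uniq_leq_size; last first.
    move=> k /mapP[y]; rewrite mem_filter => /andP[_ ys] ->.
    by rewrite mem_iota; case: (lev y ys).
  rewrite map_inj_in_uniq ?filter_uniq // => y1 y2.
  rewrite !mem_filter => /andP[nd1 s1] /andP[nd2 s2] E; apply/eqP/negPn/negP => ne.
  have [a1 lo1 hi1] := lev _ s1; have [a2 lo2 hi2] := lev _ s2.
  rewrite -E in lo2 hi2 a2.
  case: (root_path_order p s1 s2 ne) => le.
    case/negP: nd1; apply: (psi_same_level a1 (r' := r y2) (s' := r (pa y2))).
    - by rewrite lo1.
    - exact: le.
    - by rewrite lo2; case: (root_path_mem p s2).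
  case/negP: nd2; apply: (psi_same_level a1 (r' := r y1) (s' := r (pa y1))).
  - by rewrite lo2.
  - exact: le.
  - by rewrite lo1; case: (root_path_mem p s1).
(* The count is spread over all vertices to be compared with the potential term by term. *)
have sum_drops : \sum_(y : 'I_n) ((y \in s) && drops y : nat) = size (filter drops s).
  rewrite -(card_uniqP (filter_uniq drops us)) -sum1_card [RHS]big_mkcond /=.
  by apply: eq_bigr => y _; rewrite mem_filter andbC; case: ifP.
suff : potential (compress pa s z) + size (filter drops s) <= potential pa.
  by rewrite -(count_predC drops s) -!size_filter addnA => /leq_add; apply.
rewrite -sum_drops -big_split; apply: leq_sum => y _ /=; rewrite /compress.
case: (boolP (y \in s)) => [ys|_]; last by rewrite addn0.
have ne_zy : (z == y) = false by apply/eqP=> zy; rewrite zy ys in nzs.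
rewrite ne_zy (negbTE (root_path_nonroot p ys)) /=.
have : psi a (r y) (r z) <= psi a (r y) (r (pa y)).
  by apply: psi_anti; case: (root_path_mem p ys).
by rewrite /drops leq_eqVlt => /predU1P[<-|lt]; rewrite ?ltnn ?addn0 // lt addn1.
Qed.

(** The bound without the slack a, for queries, which must not raise the potential. *)
Lemma compress_potential_le x s z : root_path pa x s z ->
  potential (compress pa s z) <= potential pa.
Proof.
move=> p; apply: leq_sum => y _ /=; rewrite /compress.
case: (boolP (y \in s)) => // ys; have nzs := root_path_notin p.
have -> : (z == y) = false by apply/eqP=> zy; rewrite zy ys in nzs.
rewrite (negbTE (root_path_nonroot p ys)).
by apply: psi_anti; case: (root_path_mem p ys).
Qed.

End OnePath.
End Paths.

(** * Linking two roots *)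

Definition reparent n (pa : 'I_n -> 'I_n) x y : 'I_n -> 'I_n :=
  fun z => if z == x then y else pa z.

Section Link.
Variables (n : nat) (F : forest n) (pa : 'I_n -> 'I_n) (x y : 'I_n) (flip : bool).
Hypothesis ok_pa : parents_ok F pa.
Hypotheses (rx : rep F x = x) (ry : rep F y = y) (ne_xy : x != y).
Hypothesis le_rank : rank F x <= rank F y.

Lemma link_parents_ok : parents_ok (link F x y flip) (reparent pa x y).
Proof.
have [rp ro rk] := ok_pa.
have rank_up z : rank F z <= rank (link F x y flip) z by rewrite /=; case: ifP.
split=> z; rewrite /reparent.
- by case: (z =P x) => [->|_] /=; rewrite ?rp // rx eqxx ry eq_sym (negbTE ne_xy).
- case: (z =P x) => [->|/eqP nz] /=; first by rewrite rx eqxx.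
  rewrite ro; case: (rep F z =P x) => // rz.
  rewrite rz [x == z]eq_sym (negbTE nz); apply/esym/eqP=> yz.
  by move: ne_xy; rewrite -ry yz rz eqxx.
- case: (z =P x) => [->|/eqP nz] nr.
    by rewrite /= (negbTE ne_xy) eqxx /=; case: eqP; lia.
  apply: leq_trans (rank_up _); rewrite /= (_ : z == y = false) /= ?rk //.
  by apply/eqP=> zy; rewrite zy ro ry eqxx in nr.
Qed.

(** The term of x goes from a * rank to at most a * (rank + 2) by [psi_max], that of y gains at most
    a on a tie, and all others can only fall because ranks of parents only grow. *)
Lemma link_potential a :
  potential (link F x y flip) a (reparent pa x y) <= potential F a pa + 3 * a.
Proof.
have [rp ro rk] := ok_pa.
have pz z : rep F z = z -> pa z == z by rewrite ro => ->.
rewrite /potential (bigD1 x) // (bigD1 y) 1?eq_sym //=.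
rewrite [X in _ <= X + _](bigD1 x) // [X in _ <= _ + X + _](bigD1 y) 1?eq_sym //=.
rewrite /reparent !eqxx (negbTE ne_xy) (eq_sym y) (negbTE ne_xy) !pz //=.
set S1 := \sum_(_ | _) _; set S2 := \sum_(_ | _) _.
have leS : S1 <= S2.
  apply: leq_sum => z /andP[nx ny]; rewrite (negbTE nx) (negbTE ny) /=.
  case: ifP => // _; apply: psi_anti; rewrite ltnS; by case: ifP.
have := psi_max a (rank F x).+1 (if rank F x == rank F y then (rank F y).+1 else rank F y).+1.
rewrite mulnS mulnS; case: eqP => _; rewrite ?mulnS; lia.
Qed.

End Link.

(** * Time-bounded total correctness for the RAM *)

Definition wp (w : nat) (c : cmd) (s : state) (T : nat) (Q : state -> Prop) :=
  exists t ch s', [/\ exec w c s t ch s', t <= T & Q s'].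

Section WeakestPrecondition.
Variable w : nat.
Implicit Types (c : cmd) (s : state) (T : nat) (Q : state -> Prop).

Lemma wp_weaken c s T T' Q Q' :
  T <= T' -> (forall s', Q s' -> Q' s') -> wp w c s T Q -> wp w c s T' Q'.
Proof.
move=> le_T QQ' [t [ch [s' [e le_t Qs']]]]; exists t, ch, s'.
by split; [| apply: leq_trans le_T | apply: QQ'].
Qed.

Lemma wp_time c s T T' Q : wp w c s T Q -> T <= T' -> wp w c s T' Q.
Proof. by move=> H le_T; apply: wp_weaken H. Qed.

Lemma wp_skip s Q : Q s -> wp w Skip s 1 Q.
Proof. by move=> Qs; exists 1, [::], s; split=> //; constructor. Qed.

Lemma wp_const s x k Q :
  k < 2 ^ w -> Q (set_reg s x k) -> wp w (Const x k) s 1 Q.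
Proof.
move=> lt_k Qs; exists 1, [::], (set_reg s x k); split=> //.
by rewrite -{2}(modn_small lt_k); constructor.
Qed.

Lemma wp_move s x y Q : Q (set_reg s x (regs s y)) -> wp w (Move x y) s 1 Q.
Proof. by move=> Qs; do 3!eexists; split; [constructor | | exact: Qs]. Qed.

Lemma wp_add s x y z Q : regs s y + regs s z < 2 ^ w ->
  Q (set_reg s x (regs s y + regs s z)) -> wp w (Add x y z) s 1 Q.
Proof.
move=> lt_k Qs; do 3!eexists; split; [constructor | by [] |].
by rewrite modn_small.
Qed.

Lemma wp_read s x y Q :
  Q (set_reg s x (mem s (regs s y))) -> wp w (Read x y) s 1 Q.
Proof. by move=> Qs; do 3!eexists; split; [constructor | | exact: Qs]. Qed.

Lemma wp_write s x y Q :
  Q (set_mem s (regs s x) (regs s y)) -> wp w (Write x y) s 1 Q.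
Proof. by move=> Qs; do 3!eexists; split; [constructor | | exact: Qs]. Qed.

Lemma wp_seq c1 c2 s T1 T2 Q :
  wp w c1 s T1 (fun s1 => wp w c2 s1 T2 Q) -> wp w (Seq c1 c2) s (T1 + T2) Q.
Proof.
case=> t1 [ch1 [s1 [e1 le1 [t2 [ch2 [s2 [e2 le2 Qs2]]]]]]].
exists (t1 + t2), (ch1 ++ ch2), s2; split=> //; last exact: leq_add.
exact: exec_seq e1 e2.
Qed.

(** Adding the budgets of the branches instead of taking their maximum affects only constants. *)
Lemma wp_if b c1 c2 s T1 T2 Q :
  (eval_test b s -> wp w c1 s T1 Q) -> (~~ eval_test b s -> wp w c2 s T2 Q) ->
  wp w (If b c1 c2) s (T1 + T2).+1 Q.
Proof.
move=> H1 H2; have [t [ch [s' [e le_t Qs']]]] :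
    wp w (if eval_test b s then c1 else c2) s (T1 + T2) Q.
  case: (boolP (eval_test b s)) => [/H1 | /H2] H; apply: wp_time H _.
    exact: leq_addr.
  exact: leq_addl.
by exists t.+1, ch, s'; split=> //; constructor.
Qed.

Lemma wp_while_end b c s Q : ~~ eval_test b s -> Q s -> wp w (While b c) s 1 Q.
Proof. by move=> nb Qs; exists 1, [::], s; split=> //; apply: exec_while_end. Qed.

Lemma wp_while_step b c s T1 T2 Q : eval_test b s ->
  wp w c s T1 (fun s1 => wp w (While b c) s1 T2 Q) ->
  wp w (While b c) s (T1 + T2).+1 Q.
Proof.
move=> hb [t1 [ch1 [s1 [e1 le1 [t2 [ch2 [s2 [e2 le2 Qs2]]]]]]]].
exists (t1 + t2).+1, (ch1 ++ ch2), s2; split=> //; last by rewrite ltnS leq_add.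
exact: exec_while_step e1 e2.
Qed.

End WeakestPrecondition.

Fixpoint assigns (c : cmd) (r : reg) : bool :=
  match c with
  | Skip | Write _ _ => false
  | Const x _ | Move x _ | Add x _ _ | Sub x _ _ | Read x _ => r == x
  | Seq c1 c2 | If _ c1 c2 => assigns c1 r || assigns c2 r
  | While _ c => assigns c r
  end.

Lemma exec_frame w c s t ch s' r :
  exec w c s t ch s' -> ~~ assigns c r -> regs s' r = regs s r.
Proof.
elim=> {c s t ch s'} //=; try by move=> s x ? /negbTE->.
- by move=> s x ? ? /negbTE->.
- by move=> s x ? ? /negbTE->.
- by move=> c1 c2 s1 s2 s3 t1 t2 ch1 ch2 _ IH1 _ IH2 /norP[/IH1 <- /IH2].
- by move=> b c1 c2 s t ch s' _ IH /norP[n1 n2]; apply: IH; case: eval_test.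
- by move=> b c s1 s2 s3 t1 t2 ch1 ch2 _ _ IH1 _ IH2 nc; rewrite IH2 ?IH1.
Qed.

(** Lets [update_code] keep its second argument and the first root and color in registers 1 to 3
    during [find_code]. *)
Lemma wp_frame w c s T Q : wp w c s T Q ->
  wp w c s T (fun s' => Q s' /\ forall r, ~~ assigns c r -> regs s' r = regs s r).
Proof.
case=> t [ch [s' [e le_t Qs']]]; exists t, ch, s'; split=> //.
by split=> // r; apply: exec_frame e.
Qed.

(** A unit step changes at most one cell; recolorings are thus bounded by time for every choice of
    color cells. *)
Lemma size_changed w c s t ch s' : exec w c s t ch s' -> size ch <= t.
Proof.
elim=> {c s t ch s'} //=.
- by move=> s x y; case: ifP.
- by move=> *; rewrite size_cat leq_add.
- by move=> *; apply: leqW.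
- by move=> *; rewrite size_cat; apply/leqW/leq_add.
Qed.

(** * The programs *)

Notation "c1 ;;; c2" := (Seq c1 c2) (at level 80, right associativity).

Definition xor_code (x y z : reg) : cmd := If (TEq y z) (Const x 0) (Const x 1).

Definition xnor_code (x y z : reg) : cmd := If (TEq y z) (Const x 1) (Const x 0).

(* Registers 18 and 19 hold the constants 1 and 0. *)
Definition walk_code : cmd :=
  While (TLt 19 14)
    (Add 15 11 18 ;;; Read 15 15 ;;; xor_code 12 12 15 ;;;
     Move 11 14 ;;; Read 14 11).

(** Register 13 is the current vertex, 14 its old parent, 11 the root and 16 the parity from the
    vertex to the root; adding the old edge parity in 17 gives the parity from the parent. *)
Definition compress_code : cmd :=
  While (TLt 19 14)
    (Write 13 11 ;;; Add 15 13 18 ;;; Read 17 15 ;;; Write 15 16 ;;;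
     xor_code 16 16 17 ;;; Move 13 14 ;;; Read 14 13).

(* Takes a vertex in register 10; returns the address of its root in register
   11 and its color in register 12. *)
Definition find_code : cmd :=
  Const 19 0 ;;; Const 18 1 ;;;
  Add 13 10 10 ;;; Add 13 13 10 ;;; Add 13 13 18 ;;;
  Move 11 13 ;;; Const 12 0 ;;; Read 14 11 ;;; walk_code ;;;
  Move 16 12 ;;; Read 14 13 ;;; compress_code.

Definition query_code : cmd := Move 10 0 ;;; find_code ;;; Move 0 12.

(** On entry registers 2 and 3 hold the root and color of u, 11 and 12 those of v; registers 9 and
    13 receive the two ranks. *)
Definition link_code : cmd :=
  xnor_code 4 3 12 ;;; Const 18 1 ;;;
  Add 5 2 18 ;;; Add 6 5 18 ;;; Add 7 11 18 ;;; Add 8 7 18 ;;;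
  Read 9 6 ;;; Read 13 8 ;;;
  If (TLt 9 13) (Write 2 11 ;;; Write 5 4)
    (Write 11 2 ;;; Write 7 4 ;;;
     If (TEq 9 13) (Add 9 9 18 ;;; Write 6 9) Skip).

Definition update_code : cmd :=
  Move 10 0 ;;; find_code ;;; Move 2 11 ;;; Move 3 12 ;;;
  Move 10 1 ;;; find_code ;;; If (TEq 2 11) Skip link_code.

Definition parity_forest : data_structure :=
  DataStructure Skip update_code query_code.

(* Vertex x owns the cells base x (address of its parent, or 0 if x is a root),
   base x + 1 (parity of the edge to its parent) and base x + 2 (rank); hence
   the zeroed memory already represents the empty graph. *)
Definition base (x : nat) : addr := (3 * x).+1.

(** * Forests in memory *)

Definition represents n (F : forest n) (pa : 'I_n -> 'I_n) (m : memory) : Prop :=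
  forall x : 'I_n,
  [/\ m (base x) = (if pa x == x then 0 else base (pa x)),
      m (base x).+1 = color F x (+) color F (pa x) &
      m (base x).+2 = rank F x].

Lemma base_inj n (x y : 'I_n) : (base x == base y) = (x == y).
Proof. by apply/eqP/eqP => [E|->//]; apply: val_inj; move: E; rewrite /base /=; lia. Qed.

Lemma base_neq1 x y : (base x == (base y).+1) = false.
Proof. rewrite /base; lia. Qed.
Lemma base_neq2 x y : (base x == (base y).+2) = false.
Proof. rewrite /base; lia. Qed.
Lemma base1_neq x y : ((base x).+1 == base y) = false.
Proof. rewrite /base; lia. Qed.
Lemma base1_neq2 x y : ((base x).+1 == (base y).+2) = false.
Proof. rewrite /base; lia. Qed.
Lemma base2_neq x y : ((base x).+2 == base y) = false.
Proof. rewrite /base; lia. Qed.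
Lemma base2_neq1 x y : ((base x).+2 == (base y).+1) = false.
Proof. rewrite /base; lia. Qed.

Definition base_eqE :=
  (base_inj, base_neq1, base_neq2, base1_neq, base1_neq2, base2_neq, base2_neq1, eqSS).

Lemma eq_represents n (F : forest n) pa pa' m m' :
  pa =1 pa' -> m =1 m' -> represents F pa m -> represents F pa' m'.
Proof. by move=> Ep Em R x; rewrite -Ep -!Em; apply: R. Qed.

Lemma represents_reparent n (F : forest n) pa m (x z : 'I_n) :
  represents F pa m -> z != x ->
  represents F (reparent pa x z)
    [eta [eta m with base x |-> base z]
       with (base x).+1 |-> (color F x (+) color F z : nat)].
Proof.
move=> R ne_zx y; have [R0 R1 R2] := R y.
rewrite /= !base_eqE /reparent; case: (y =P x) => [->|_] //=.
by rewrite (negbTE ne_zx); have [_ _ ->] := R x.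
Qed.

(** Both ends of an old edge flip together, so its parity stays; roots have color 0, so the new edge
    gets parity [flip]. The rank cell counts as written even without a tie, which gives one formula
    for all branches of [link_code]. *)
Lemma represents_link n (F : forest n) pa m (x y : 'I_n) flip :
  forest_ok F -> parents_ok F pa -> represents F pa m ->
  rep F x = x -> rep F y = y -> x != y ->
  represents (link F x y flip) (reparent pa x y)
    [eta [eta [eta m with base x |-> base y] with (base x).+1 |-> (flip : nat)]
       with (base y).+2 |->
         (if rank F x == rank F y then (rank F y).+1 else rank F y)].
Proof.
move=> okF ok_pa R rx ry ne_xy z; have [R0 R1 R2] := R z.
have col0 t : rep F t = t -> color F t = false by move=> <-; apply: color_rep.
rewrite /= !base_eqE /reparent; case: (z =P x) => [->|_] /=.
  rewrite eq_sym (negbTE ne_xy) rx ry eqxx eq_sym (negbTE ne_xy) !col0 //=.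
  by have [_ _ ->] := R x; rewrite addbF.
rewrite R0 R1 R2 (rep_parent ok_pa); split=> //; last by case: (z =P y) => // ->.
by rewrite addbACA addbb addbF.
Qed.

(** * Correctness and running time of the procedures *)

Section Procedures.
Variables (n w : nat) (F : forest n).
Hypotheses (lt_w : 3 * n + 3 < 2 ^ w) (okF : forest_ok F).
Implicit Types (s : state) (Q : state -> Prop) (pa : 'I_n -> 'I_n) (b : bool).

Lemma base_lt (x : 'I_n) : (base x).+2 < 2 ^ w.
Proof. by rewrite /base; have := ltn_ord x; lia. Qed.

Lemma bit_lt b : b < 2 ^ w.
Proof. by move: lt_w; case: b; lia. Qed.

Lemma wp_xor s x y z b1 b2 Q : regs s y = b1 -> regs s z = b2 ->
  Q (set_reg s x (b1 (+) b2)) -> wp w (xor_code x y z) s 3 Q.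
Proof.
move=> e1 e2 Qs; apply: (@wp_if _ _ _ _ _ 1 1) => /=; rewrite e1 e2 => e;
  apply: wp_const; rewrite ?(bit_lt false) ?(bit_lt true) //.
all: by move: b1 b2 e Qs {e1 e2} => [] [].
Qed.

Lemma wp_xnor s x y z b1 b2 Q : regs s y = b1 -> regs s z = b2 ->
  Q (set_reg s x (~~ (b1 (+) b2))) -> wp w (xnor_code x y z) s 3 Q.
Proof.
move=> e1 e2 Qs; apply: (@wp_if _ _ _ _ _ 1 1) => /=; rewrite e1 e2 => e;
  apply: wp_const; rewrite ?(bit_lt false) ?(bit_lt true) //.
all: by move: b1 b2 e Qs {e1 e2} => [] [].
Qed.

(** Edge parities telescope to the color difference of x and z; each iteration takes 8 steps, test
    included. *)
Lemma walk_wp pa x l z b s Q : represents F pa (mem s) ->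
  root_path pa x l z ->
  regs s 11 = base x -> regs s 12 = b -> regs s 14 = mem s (base x) ->
  regs s 18 = 1 -> regs s 19 = 0 ->
  (forall s', mem s' = mem s -> regs s' 11 = base z ->
     regs s' 12 = b (+) (color F x (+) color F z) ->
     regs s' 13 = regs s 13 -> regs s' 18 = 1 -> regs s' 19 = 0 -> Q s') ->
  wp w walk_code s (8 * size l + 1) Q.
Proof.
elim: l x b s => [|y l IHl] x b s R /= p r11 r12 r14 r18 r19 QH.
  case: p => xz; subst x => rz; have [R0 _ _] := R z; rewrite rz in R0.
  apply: wp_while_end; first by rewrite /= r14 R0 r19.
  by apply: QH; rewrite // addbb addbF.
case: p => _ nx p; have [R0 R1 _] := R x; rewrite (negbTE nx) in R0.
apply: (wp_time (T := (1 + (1 + (3 + (1 + 1))) + (8 * size l + 1)).+1)); last lia.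
apply: wp_while_step; first by rewrite /= r14 R0 r19.
apply: wp_seq; apply: wp_add => /=.
  by rewrite r11 r18 addn1; apply: ltnW (base_lt x).
apply: wp_seq; apply: wp_read => /=; rewrite r11 r18 addn1 R1.
apply: wp_seq; apply: wp_xor => /=; [exact: r12 | by [] |].
apply: wp_seq; apply: wp_move => /=; apply: wp_read => /=.
apply: (IHl (pa x)) => //=; try by rewrite r14 R0.
move=> s' m' r11' r12' r13' r18' r19'; apply: QH => //.
by rewrite r12' -!addbA addKb.
Qed.

Lemma root_path_reparent pa x y l z : y \notin l -> y != z ->
  root_path pa x l z -> root_path (reparent pa y z) x l z.
Proof.
move=> nyl nyz; elim: l x nyl => [|t l IHl] x /=.
  by move=> _ [-> rz]; rewrite /reparent (eq_sym z) (negbTE nyz).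
rewrite inE => /norP[nyt nyl] [tx nx p]; subst t.
have -> : reparent pa y z x = pa x by rewrite /reparent (eq_sym x) (negbTE nyt).
by split=> //; apply: IHl.
Qed.

Lemma compress_wp pa x l z s Q : represents F pa (mem s) ->
  root_path pa x l z -> uniq l ->
  regs s 11 = base z -> regs s 13 = base x -> regs s 14 = mem s (base x) ->
  regs s 16 = color F x (+) color F z -> regs s 18 = 1 -> regs s 19 = 0 ->
  (forall s', represents F (compress pa l z) (mem s') -> regs s' 11 = base z ->
     regs s' 12 = regs s 12 -> Q s') ->
  wp w compress_code s (10 * size l + 1) Q.
Proof.
elim: l pa x s => [|y l IHl] pa x s R /= p ul r11 r13 r14 r16 r18 r19 QH.
  case: p => xz; subst x => rz; have [R0 _ _] := R z; rewrite rz in R0.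
  by apply: wp_while_end; [rewrite /= r14 R0 r19 | apply: QH].
case: p ul => yx nx p /andP[nxl ul]; subst y.
have [R0 R1 _] := R x; rewrite (negbTE nx) in R0.
have nzx : z != x.
  by apply: contraNneq nx => <-; apply: root_path_end p.
apply: (wp_time (T := (1 + (1 + (1 + (1 + (3 + (1 + 1))))) +
                        (10 * size l + 1)).+1)); last lia.
apply: wp_while_step; first by rewrite /= r14 R0 r19.
apply: wp_seq; apply: wp_write => /=.
apply: wp_seq; apply: wp_add => /=.
  by rewrite r13 r18 addn1; apply: ltnW (base_lt x).
apply: wp_seq; apply: wp_read => /=; rewrite r13 r11 r18 addn1 base_eqE R1.
apply: wp_seq; apply: wp_write => /=.
apply: wp_seq; apply: wp_xor => /=; [exact: r16 | by [] |].
apply: wp_seq; apply: wp_move => /=; apply: wp_read => /=.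
have R' := represents_reparent R nzx.
(* The induction continues with x already redirected, which leaves the rest of the path intact. *)
apply: (IHl (reparent pa x z) (pa x)) => //=.
- by rewrite r16.
- by apply: root_path_reparent; rewrite // eq_sym.
- by rewrite r14 R0.
- by rewrite r14 R0.
- by rewrite addbACA addbb /= addbC.
move=> s' Rs' r11' r12'; apply: QH => //.
apply: eq_represents Rs' => // y; rewrite /compress /reparent inE.
by case: (y =P x) => [->|_] //=; rewrite if_same.
Qed.

Lemma find_wp pa x l s Q : represents F pa (mem s) -> parents_ok F pa ->
  root_path pa x l (rep F x) -> regs s 10 = x ->
  (forall s', represents F (compress pa l (rep F x)) (mem s') ->
     regs s' 11 = base (rep F x) -> regs s' 12 = color F x ->
     (forall r, ~~ assigns find_code r -> regs s' r = regs s r) -> Q s') ->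
  wp w find_code s (18 * size l + 12) Q.
Proof.
move=> R ok_pa p r10 QH.
suff /wp_frame : wp w find_code s (18 * size l + 12) (fun s' =>
    [/\ represents F (compress pa l (rep F x)) (mem s'),
        regs s' 11 = base (rep F x) & regs s' 12 = color F x]).
  by apply: wp_weaken => // s' [[? ? ?] ?]; apply: QH.
have lt_b := base_lt x; have lt1 := bit_lt true; have lt0 := bit_lt false.
(* Each path vertex costs 8 + 10 steps; the 12 are ten straight-line instructions and the two final
   loop tests. *)
apply: (wp_time (T := 1 + (1 + (1 + (1 + (1 + (1 + (1 + (1 +
   ((8 * size l + 1) + (1 + (1 + (10 * size l + 1))))))))))))); last lia.
apply: wp_seq; apply: wp_const => //.
apply: wp_seq; apply: wp_const => //.
apply: wp_seq; apply: wp_add => /=; rewrite r10.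
  by move: lt_b; rewrite /base; lia.
apply: wp_seq; apply: wp_add => /=; rewrite r10.
  by move: lt_b; rewrite /base; lia.
apply: wp_seq; apply: wp_add => /=.
  by move: lt_b; rewrite /base; lia.
have -> : x + x + x + 1 = base x by rewrite /base; lia.
apply: wp_seq; apply: wp_move => /=.
apply: wp_seq; apply: wp_const => //.
apply: wp_seq; apply: wp_read => /=.
apply: wp_seq; apply: (walk_wp (pa := pa) (b := false) _ p) => //= s1 m1 r11 r12 r13 r18 r19.
apply: wp_seq; apply: wp_move => /=.
apply: wp_seq; apply: wp_read => /=.
apply: (compress_wp _ p) => //=.
- by rewrite m1.
- exact (root_path_uniq ok_pa p).
- by rewrite r13.
- by move=> s' Rs' r11' r12'; split; rewrite // r12' r12 color_rep // addbF.
Qed.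

Lemma link_wp a pa u v s Q : represents F pa (mem s) -> parents_ok F pa ->
  rep F u != rep F v ->
  regs s 2 = base (rep F u) -> regs s 3 = color F u ->
  regs s 11 = base (rep F v) -> regs s 12 = color F v ->
  (forall s' pa', represents (unite F u v) pa' (mem s') ->
     parents_ok (unite F u v) pa' ->
     potential (unite F u v) a pa' <= potential F a pa + 3 * a -> Q s') ->
  wp w link_code s 19 Q.
Proof.
move=> R ok_pa ne r2 r3 r11 r12; rewrite /unite (negbTE ne).
set x := rep F u in ne r2 *; set y := rep F v in ne r11 *.
have rx : rep F x = x by apply: rep_idem.
have ry : rep F y = y by apply: rep_idem.
move=> QH; have lt_bx := base_lt x; have lt_by := base_lt y.
have [_ _ Rx] := R x; have [_ _ Ry] := R y.
apply: (wp_time (T := 3 + (1 + (1 + (1 + (1 + (1 + (1 + (1 +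
  (1 + 1 + (1 + (1 + (1 + 1 + 1).+1))).+1))))))))) => //.
apply: wp_seq; apply: (wp_xnor r3 r12).
apply: wp_seq; apply: wp_const; first exact: bit_lt true.
do 2!(apply: wp_seq; apply: wp_add => /=; rewrite ?r2 ?(addn1 (base x)) ?(addn1 (base x).+1); first lia).
do 2!(apply: wp_seq; apply: wp_add => /=; rewrite ?r11 ?(addn1 (base y)) ?(addn1 (base y).+1); first lia).
apply: wp_seq; apply: wp_read => /=; rewrite Rx.
apply: wp_seq; apply: wp_read => /=; rewrite Ry.
apply: wp_if => /=; [move=> lt_xy | rewrite -leqNgt => le_yx].
  rewrite lt_xy in QH.
  apply: wp_seq; apply: wp_write => /=; apply: wp_write => /=; rewrite r2 r11.
  apply: QH; last 1 first.
  - by apply: link_potential => //; apply: ltnW.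
  - apply: eq_represents (represents_link _ okF ok_pa R rx ry ne) => // k /=.
    rewrite (ltn_eqF lt_xy); case: (k =P (base y).+2) => // ->.
    by rewrite !base_eqE Ry.
  - by apply: link_parents_ok => //; apply: ltnW.
(* Here the root of u wins, so x and y exchange roles. *)
rewrite ltnNge le_yx /= in QH; rewrite eq_sym in ne.
apply: wp_seq; apply: wp_write => /=.
apply: wp_seq; apply: wp_write => /=.
have ok' flip := link_parents_ok flip ok_pa ry rx ne le_yx.
have pot' flip := link_potential flip ok_pa ry rx ne le_yx a.
have R' flip := represents_link flip okF ok_pa R ry rx ne.
apply: wp_if => /=; rewrite r2 r11 => eq_xy.
  apply: wp_seq; apply: wp_add => /=.
    by have := rank_lt okF x; lia.
  apply: wp_write => /=; apply: QH (ok' _) (pot' _).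
  apply: eq_represents (R' _) => // k /=.
  by rewrite (eq_sym (rank F y)) eq_xy addn1.
apply: wp_skip; apply: QH (ok' _) (pot' _).
apply: eq_represents (R' _) => // k /=.
rewrite (eq_sym (rank F y)) (negbTE eq_xy); case: (k =P (base x).+2) => // ->.
by rewrite !base_eqE Rx.
Qed.

End Procedures.

(** * Amortized cost of single operations *)

Lemma wp_op_step w D n (o : op n) m T (Q : state -> Prop) :
  wp w (op_code D o) (start (op_args o) m) T Q ->
  exists r m', [/\ op_step w D o m r m', cost r <= T, size (changed r) <= cost r
    & exists s, [/\ Q s, mem s = m' & regs s 0 = answer r]].
Proof.
case=> t [ch [s [e le_t Qs]]]; exists (Outcome t ch (regs s 0)), (mem s).
by split=> //=; [exists s | apply: size_changed e | exists s].
Qed.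

Section Operations.
Variables (n w a : nat) (F : forest n) (pa : 'I_n -> 'I_n) (m : memory).
Hypotheses (lt_w : 3 * n + 3 < 2 ^ w) (okF : forest_ok F).
Hypotheses (ok_pa : parents_ok F pa) (R : represents F pa m).
Hypothesis grow_a : forall r, 0 < r -> n < grow a r.

(** The factor 18 is the time of [find_code] per path vertex, so the released potential pays for the
    path up to 18 * a. The budget is that of updates, for uniformity. *)
Lemma query_amortized (v : 'I_n) : exists r m' pa',
  [/\ op_step w parity_forest (GetColor v) m r m' /\ answer r = color F v,
      represents F pa' m', parents_ok F pa',
      cost r + 18 * potential F a pa' <= 18 * potential F a pa + (90 * a + 49) &
      potential F a pa' <= potential F a pa].
Proof.
have [l p] := root_path_exists okF v ok_pa.
have pot := compress_potential okF ok_pa grow_a p.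
have : wp w (op_code parity_forest (GetColor v)) (start [:: val v] m)
    (1 + ((18 * size l + 12) + 1))
    (fun s => represents F (compress pa l (rep F v)) (mem s) /\
              regs s 0 = color F v).
  apply: wp_seq; apply: wp_move => /=; apply: wp_seq.
  apply: (find_wp lt_w okF _ ok_pa p) => //= s Rs _ r12 _.
  by apply: wp_move => /=; rewrite r12.
case/wp_op_step => r [m' [step le_t _ [s [[Rs r0] def_m' ans]]]]; subst m'.
exists r, (mem s), (compress pa l (rep F v)); split=> //; last 2 first.
- by move: le_t; lia.
- exact (compress_potential_le a ok_pa p).
- by move: step; rewrite -ans.
- exact (compress_ok ok_pa p).
Qed.

(** 90 = 18 * (1 + 1 + 3): each of the two compressions has slack a and the link adds 3 * a; 49 is
    the time spent outside the loop iterations. *)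
Lemma update_amortized (u v : 'I_n) : exists r m' pa',
  [/\ op_step w parity_forest (Insert u v) m r m',
      represents (unite F u v) pa' m', parents_ok (unite F u v) pa',
      cost r + 18 * potential (unite F u v) a pa' <=
        18 * potential F a pa + (90 * a + 49) &
      size (changed r) <= cost r].
Proof.
have [l p] := root_path_exists okF u ok_pa.
have pot := compress_potential okF ok_pa grow_a p.
have ok_pa1 := compress_ok ok_pa p.
set pa1 := compress pa l (rep F u) in pot ok_pa1.
have [l2 p2] := root_path_exists okF v ok_pa1.
have pot2 := compress_potential okF ok_pa1 grow_a p2.
have ok_pa2 := compress_ok ok_pa1 p2.
set pa2 := compress pa1 l2 (rep F v) in pot2 ok_pa2.
have : wp w (op_code parity_forest (Insert u v)) (start [:: val u; val v] m)
    (1 + ((18 * size l + 12) + (1 + (1 + (1 + ((18 * size l2 + 12) + (1 + 19).+1))))))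
    (fun s => exists pa', [/\ represents (unite F u v) pa' (mem s),
       parents_ok (unite F u v) pa' &
       potential (unite F u v) a pa' <= potential F a pa2 + 3 * a]).
  apply: wp_seq; apply: wp_move => /=; apply: wp_seq.
  apply: (find_wp lt_w okF _ ok_pa p) => //= s1 R1 r11 r12 fr1.
  have r1 : regs s1 1 = v by rewrite fr1.
  apply: wp_seq; apply: wp_move; apply: wp_seq; apply: wp_move.
  apply: wp_seq; apply: wp_move => /=; apply: wp_seq.
  apply: (find_wp lt_w okF _ ok_pa1 p2) => //= s2 R2 r11' r12' fr2.
  have r2 : regs s2 2 = base (rep F u) by rewrite fr2.
  have r3 : regs s2 3 = color F u by rewrite fr2.
  apply: wp_if => /=; rewrite r2 r11' base_inj => same.
    apply: wp_skip; exists pa2.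
    have -> : unite F u v = F by rewrite /unite same.
    by split=> //; apply: leq_addr.
  apply: (link_wp (a := a) lt_w okF R2 ok_pa2 same) => // s3 pa3 R3 ok3 pot3.
  by exists pa3.
case/wp_op_step => r [m' [step le_t le_ch [s [[pa3 [R3 ok3 pot3]] def_m' _]]]]; subst m'.
exists r, (mem s), pa3; split=> //.
by move: le_t; lia.
Qed.

End Operations.

(** * Whole histories *)

(** The power P of 2 exceeds n and is at least 2, so P^3 >= 4 * P > 3 * n + 3; all addresses, ranks
    and bits then fit in a word. *)
Lemma word_size_gt n : 3 * n + 3 < 2 ^ word_size 3 n.
Proof.
rewrite /word_size (mulnC 3 _.+1) expnM; set P := 2 ^ _.+1.
have lt_nP : n < P by apply: trunc_log_ltn.
have P_ge2 : 2 <= P by rewrite /P expnS; have := expn_gt0 2 (trunc_log 2 n); lia.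
rewrite !expnS expn0; nia.
Qed.

Lemma recolorings_rcons cc n (h : seq (op n)) tr o r : size tr = size h ->
  recolorings cc (rcons h o) (rcons tr r) =
  recolorings cc h tr + (if is_update o then count cc (changed r) else 0).
Proof.
move=> sz; rewrite /recolorings zip_rcons // -cats1 big_cat big_cons big_nil /=.
by case: ifP; rewrite ?addn0.
Qed.

(** One potential serves two accounts: time is charged to all operations, recolorings to updates
    only. *)
Lemma run_amortized n (h : seq (op n)) :
  let a := (alpha n).+2 in let F := forest_of h in let B := 90 * a + 49 in
  exists tr m pa,
  [/\ run (word_size 3 n) parity_forest (fun=> 0) h tr m,
      size tr = size h,
      represents F pa m /\ parents_ok F pa,
      total_time tr + 18 * potential F a pa <= B * size h &
      forall cc, recolorings cc h tr + 18 * potential F a pa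
                 <= B * count (@is_update n) h].
Proof.
move=> a; set B := 90 * a + 49.
have lt_w := word_size_gt n; have grow_a r : 0 < r -> n < grow a r := @grow_alpha n r.
elim/last_ind: h => [|h o [tr [m [pa [runh sz [R ok_pa] time rec]]]]].
  have pot0 : potential (empty_forest n) a id = 0.
    by rewrite /potential big1 // => x _; rewrite eqxx muln0.
  exists [::], (fun=> 0), id; split=> //.
  - exact: run_nil.
  - by split; [split; rewrite //= eqxx | split=> //= x; rewrite eqxx].
  - by rewrite /total_time big_nil pot0.
  - by move=> cc; rewrite /recolorings big_nil pot0.
have okF := forest_of_ok h.
rewrite forest_of_rcons; case: o => [u v|v] /=.
  have [r [m' [pa' [step R' ok' pot ch]]]] :=
    update_amortized lt_w okF ok_pa R grow_a u v.
  exists (rcons tr r), m', pa'; split=> //.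
  - exact: run_rcons runh step.
  - by rewrite !size_rcons sz.
  - rewrite /total_time -cats1 big_cat big_seq1 size_rcons mulnS.
    by move: time pot; rewrite /total_time -/B /=; lia.
  - move=> cc; rewrite recolorings_rcons //= -cats1 count_cat /= mulnDr muln1.
    by move: (rec cc) (count_size cc (changed r)) pot; rewrite -/B; lia.
have [r [m' [pa' [[step _] R' ok' pot le]]]] :=
  query_amortized lt_w okF ok_pa R grow_a v.
exists (rcons tr r), m', pa'; split=> //.
- exact: run_rcons runh step.
- by rewrite !size_rcons sz.
- rewrite /total_time -cats1 big_cat big_seq1 size_rcons mulnS.
  by move: time pot; rewrite /total_time -/B /=; lia.
- move=> cc; rewrite recolorings_rcons //= -cats1 count_cat /= addn0 addn0.
  have := rec cc; lia.
Qed.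

Theorem theorem4 :
  exists (D : data_structure) (c C : nat), 0 < c /\
  forall n : nat,
  exists (t0 : nat) (m0 : memory) (col : seq (op n) -> 'I_n -> bool),
    [/\ init_step (word_size c n) D n t0 m0,
        t0 <= C * n.+1,
        (forall (h : seq (op n)) (v : 'I_n),
           col (rcons h (GetColor v)) = col h) &
        forall h : seq (op n), bipartite (adj h) ->
        exists (tr : seq outcome) (m : memory),
          [/\ run (word_size c n) D m0 h tr m,
              proper_coloring (adj h) (col h),
              (forall v : 'I_n, exists (r : outcome) (m' : memory),
                 op_step (word_size c n) D (GetColor v) m r m' /\
                 answer r = col h v),
              total_time tr <= C * alpha n * count (@is_update n) h
                               + C * alpha n * count (@is_query n) h &
              forall color_cell : pred addr,
                recolorings color_cell h tr
                  <= C * alpha n * count (@is_update n) h]].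
Proof.
(* 3 comes from [word_size_gt]; 319 = 90 + 2 * 90 + 49 absorbs the shift by 2 and the constant, as
   [alpha n] is at least 1. *)
exists parity_forest, 3, 319; split=> // n.
exists 1, (fun=> 0), (fun h => color (forest_of h)); split.
- exists [::], (start [:: n] (fun=> 0)); split=> //; exact: exec_skip.
- by rewrite mulnS.
- by move=> h v; rewrite forest_of_rcons.
move=> h bip; have [tr [m [pa [runh _ [R ok_pa] time rec]]]] := run_amortized h.
have le_C : 90 * (alpha n).+2 + 49 <= 319 * alpha n.
  by have [] := alphaP n; lia.
exists tr, m; split=> //.
- exact: color_proper.
- move=> v; have [r [m' [pa' [step _ _ _ _]]]] :=
    query_amortized (word_size_gt n) (forest_of_ok h) ok_pa R (@grow_alpha n) v.
  by exists r, m'.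
- rewrite -mulnDr (count_predC (@is_update n)).
  apply: leq_trans (leq_trans (leq_addr _ _) time) _.
  by rewrite leq_mul2r le_C orbT.
- move=> cc; apply: leq_trans (leq_trans (leq_addr _ _) (rec cc)) _.
  by rewrite leq_mul2r le_C orbT.
Qed.
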